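(* Let $\mathbf{R}$ be the affine (non-empty finitary) powerset monad and $\mathbf{M}$ the maybe monad on the category of sets. Post-selection $\mathsf{p}\colon\mathbf{R}\mathbf{M}X\to\mathbf{M}\mathbf{R}X$ and inclusion $\mathsf{i}\colon\mathbf{M}\mathbf{R}X\to\mathbf{R}\mathbf{M}X$ form a sesquilaw $(\mathbf{M},\mathbf{R},\mathsf{i},\mathsf{p})$ of $\mathbf{R}$ over $\mathbf{M}$.
   Context: Affine powerset monad: $\mathbf{R}X=\{U\subseteq X\mid U\text{ finite and }U\neq\varnothing\}$, multiplication $\mu^{\mathbf R}(A)=\bigcup_{U\in A}U$, unit $\eta^{\mathbf R}(x)=\{x\}$. Maybe monad: $\mathbf{M}X=X+\{\bot\}$, with unit the inclusion and multiplication $\mathbf{M}\mathbf{M}X=X+\{\bot_1\}+\{\bot_2\}\to\mathbf{M}X$ sending both extra points to $\bot$. Post-selection: for $A\in\mathbf{R}X$, $\mathsf{p}(A\cup\{\bot\})=\mathsf{p}(A)=A$, and $\mathsf{p}(\{\bot\})=\bot$. Inclusion: $\mathsf{i}(\bot)=\{\bot\}$ and $\mathsf{i}(A)=A$ for $A\in\mathbf{R}X$. For monads $(S,\mu^S,\eta^S)$ and $(T,\mu^T,\eta^T)$ on the same category: A distributive law of $S$ over $T$ is a natural transformation $m_X\colon STX\to TSX$ with $m_X\circ\mu^S_{TX}=T(\mu^S_X)\circ m_{SX}\circ S(m_X)$; $m_X\circ\eta^S_{TX}=T(\eta^S_X)$; $m_X\circ S(\mu^T_X)=\mu^T_{SX}\circ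 T(m_X)\circ m_{TX}$; $m_X\circ S(\eta^T_X)=\eta^T_{SX}$. An almost-distributive law of $T$ over $S$ is a natural transformation $n_X\colon TSX\to STX$ with $n_X\circ T(\mu^S_X)=\mu^S_{TX}\circ S(n_X)\circ n_{SX}$; $n_X\circ\eta^T_{SX}=S(\eta^T_X)$; $n_X\circ T(\eta^S_X)=\eta^S_{TX}$. A sesquilaw $(S,T,m,n)$ of $T$ over $S$ consists of a distributive law $m\colon ST\to TS$ and an almost-distributive law $n\colon TS\to ST$ such that (1) $n_X\circ\mu^T_{SX}\circ T(m_X)=S(\mu^T_X)\circ n_{TX}$ as maps $TSTX\to STX$, and (2) $n_X\circ m_X=\mathrm{id}_{STX}$. *)

(* Defs.v *)
From mathcomp Require Import all_boot all_classical.

Set Implicit Arguments.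
Unset Strict Implicit.
Unset Printing Implicit Defensive.

Local Open Scope classical_set_scope.

(* The category of sets is the category of types and functions; as functional
   extensionality is available, equality of morphisms is Leibniz equality. *)

Record functor := Functor {
  fobj :> Type -> Type;
  fmap : forall X Y : Type, (X -> Y) -> fobj X -> fobj Y;
  fmap_id : forall X : Type, fmap (@id X) = id;
  fmap_comp : forall (X Y Z : Type) (g : Y -> Z) (f : X -> Y),
    fmap (g \o f) = fmap g \o fmap f }.

Arguments fmap F {X Y} f : rename.

Record monad := Monad {
  monad_functor :> functor;
  eta : forall X : Type, X -> monad_functor X;
  mu : forall X : Type, monad_functor (monad_functor X) -> monad_functor X;
  eta_natural : forall (X Y : Type) (f : X -> Y),
    fmap monad_functor f \o eta (X := X) = eta (X := Y) \o f;
  mu_natural : forall (X Y : Type) (f : X -> Y),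
    fmap monad_functor f \o mu (X := X)
    = mu (X := Y) \o fmap monad_functor (fmap monad_functor f);
  mu_etal : forall X : Type, mu (X := X) \o eta (X := monad_functor X) = id;
  mu_etar : forall X : Type,
    mu (X := X) \o fmap monad_functor (eta (X := X)) = id;
  mu_assoc : forall X : Type,
    mu (X := X) \o mu (X := monad_functor X)
    = mu (X := X) \o fmap monad_functor (mu (X := X)) }.

Arguments eta T X : rename, clear implicits.
Arguments mu T X : rename, clear implicits.

Record distributive_law (S T : monad)
    (m : forall X : Type, S (T X) -> T (S X)) : Prop := DistributiveLaw {
  dist_natural : forall (X Y : Type) (f : X -> Y),
    fmap T (fmap S f) \o m X = m Y \o fmap S (fmap T f);
  dist_muS : forall X : Type,
    m X \o mu S (T X) = fmap T (mu S X) \o m (S X) \o fmap S (m X);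
  dist_etaS : forall X : Type, m X \o eta S (T X) = fmap T (eta S X);
  dist_muT : forall X : Type,
    m X \o fmap S (mu T X) = mu T (S X) \o fmap T (m X) \o m (T X);
  dist_etaT : forall X : Type, m X \o fmap S (eta T X) = eta T (S X) }.

(* An almost-distributive law of T over S: no compatibility with the
   multiplication of T is required. *)
Record almost_distributive_law (T S : monad)
    (n : forall X : Type, T (S X) -> S (T X)) : Prop := AlmostDistributiveLaw {
  almost_dist_natural : forall (X Y : Type) (f : X -> Y),
    fmap S (fmap T f) \o n X = n Y \o fmap T (fmap S f);
  almost_dist_muS : forall X : Type,
    n X \o fmap T (mu S X) = mu S (T X) \o fmap S (n X) \o n (S X);
  almost_dist_etaT : forall X : Type, n X \o eta T (S X) = fmap S (eta T X);
  almost_dist_etaS : forall X : Type, n X \o fmap T (eta S X) = eta S (T X) }.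

(* (S, T, m, n) is a sesquilaw of T over S *)
Record sesquilaw (S T : monad)
    (m : forall X : Type, S (T X) -> T (S X))
    (n : forall X : Type, T (S X) -> S (T X)) : Prop := Sesquilaw {
  sesqui_dist : distributive_law m;
  sesqui_almost_dist : almost_distributive_law n;
  sesqui_mu : forall X : Type,
    n X \o mu T (S X) \o fmap T (m X) = fmap S (mu T X) \o n (T X);
  sesqui_section : forall X : Type, n X \o m X = id }.

Arguments distributive_law : clear implicits.
Arguments almost_distributive_law : clear implicits.
Arguments sesquilaw : clear implicits.

Record affine_powerset (X : Type) : Type := AffinePowerset {
  elements :> set X;
  elements_finite : finite_set elements;
  elements_neq0 : elements !=set0 }.

Lemma affine_powerset_ext (X : Type) (A B : affine_powerset X) :
  elements A = elements B -> A = B.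
Proof.
case: A B => [A Af A0] [B Bf B0] /= AB; subst B.
by congr AffinePowerset; exact: Prop_irrelevance.
Qed.

Definition powerset_map (X Y : Type) (f : X -> Y) (A : affine_powerset X) :
  affine_powerset Y :=
  @AffinePowerset Y (f @` A) (finite_image f (elements_finite A))
    (image_nonempty f (elements_neq0 A)).

Definition powerset_eta (X : Type) (x : X) : affine_powerset X :=
  @AffinePowerset X [set x] (finite_set1 x) (ex_intro _ x erefl).

Lemma powerset_mu_finite (X : Type) (A : affine_powerset (affine_powerset X)) :
  finite_set (\bigcup_(U in A) U).
Proof.
by apply: bigcup_finite (elements_finite A) _ => U _; exact: elements_finite.
Qed.

Lemma powerset_mu_neq0 (X : Type) (A : affine_powerset (affine_powerset X)) :
  \bigcup_(U in A) U !=set0.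
Proof.
have [U AU] := elements_neq0 A; have [x Ux] := elements_neq0 U.
by exists x, U.
Qed.

Definition powerset_mu (X : Type) (A : affine_powerset (affine_powerset X)) :
  affine_powerset X :=
  @AffinePowerset X (\bigcup_(U in A) U)
    (powerset_mu_finite A) (powerset_mu_neq0 A).

Lemma powerset_map_id (X : Type) : powerset_map (@id X) = id.
Proof. by apply/funext => A; apply: affine_powerset_ext; exact: image_id. Qed.

Lemma powerset_map_comp (X Y Z : Type) (g : Y -> Z) (f : X -> Y) :
  powerset_map (g \o f) = powerset_map g \o powerset_map f.
Proof.
by apply/funext => A; apply: affine_powerset_ext; rewrite /= image_comp.
Qed.

Definition powerset_functor : functor :=
  Functor powerset_map_id powerset_map_comp.

Lemma powerset_eta_natural (X Y : Type) (f : X -> Y) :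
  powerset_map f \o @powerset_eta X = @powerset_eta Y \o f.
Proof.
by apply/funext => x; apply: affine_powerset_ext; rewrite /= image_set1.
Qed.

Lemma powerset_mu_natural (X Y : Type) (f : X -> Y) :
  powerset_map f \o @powerset_mu X
  = @powerset_mu Y \o powerset_map (powerset_map f).
Proof.
apply/funext => A; apply: affine_powerset_ext.
by rewrite /= image_bigcup bigcup_image.
Qed.

Lemma powerset_mu_etal (X : Type) :
  @powerset_mu X \o @powerset_eta (affine_powerset X) = id.
Proof.
by apply/funext => A; apply: affine_powerset_ext; rewrite /= bigcup_set1.
Qed.

Lemma powerset_mu_etar (X : Type) :
  @powerset_mu X \o powerset_map (@powerset_eta X) = id.
Proof.
apply/funext => A; apply: affine_powerset_ext; rewrite /= bigcup_image.
by apply/seteqP; split=> [x [y Ay ->] //|x Ax]; exists x.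
Qed.

Lemma powerset_mu_assoc (X : Type) :
  @powerset_mu X \o @powerset_mu (affine_powerset X)
  = @powerset_mu X \o powerset_map (@powerset_mu X).
Proof.
apply/funext => A; apply: affine_powerset_ext; rewrite /= bigcup_image.
apply/seteqP; split=> [x [U [V AV VU] Ux]|x [V AV [U VU Ux]]].
  by exists V => //; exists U.
by exists U => //; exists V.
Qed.

Definition powerset_monad : monad :=
  @Monad powerset_functor powerset_eta powerset_mu
    powerset_eta_natural powerset_mu_natural
    powerset_mu_etal powerset_mu_etar powerset_mu_assoc.

(* M X = X + {bot}, with None as bot *)
Lemma option_map_id (X : Type) : omap (@id X) = id.
Proof. by apply/funext => -[]. Qed.

Lemma option_map_comp (X Y Z : Type) (g : Y -> Z) (f : X -> Y) :
  omap (g \o f) = omap g \o omap f.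
Proof. by apply/funext => -[]. Qed.

Definition maybe_functor : functor :=
  @Functor option (fun X Y f => @omap X Y f) option_map_id option_map_comp.

Definition maybe_mu (X : Type) (x : option (option X)) : option X :=
  if x is Some y then y else None.

Lemma maybe_eta_natural (X Y : Type) (f : X -> Y) :
  omap f \o @Some X = @Some Y \o f.
Proof. by []. Qed.

Lemma maybe_mu_natural (X Y : Type) (f : X -> Y) :
  omap f \o @maybe_mu X = @maybe_mu Y \o omap (omap f).
Proof. by apply/funext => -[]. Qed.

Lemma maybe_mu_etal (X : Type) : @maybe_mu X \o @Some (option X) = id.
Proof. by []. Qed.

Lemma maybe_mu_etar (X : Type) : @maybe_mu X \o omap (@Some X) = id.
Proof. by apply/funext => -[]. Qed.

Lemma maybe_mu_assoc (X : Type) :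
  @maybe_mu X \o @maybe_mu (option X) = @maybe_mu X \o omap (@maybe_mu X).
Proof. by apply/funext => -[]. Qed.

Definition maybe_monad : monad :=
  @Monad maybe_functor (fun X => @Some X) maybe_mu
    maybe_eta_natural maybe_mu_natural
    maybe_mu_etal maybe_mu_etar maybe_mu_assoc.

Definition inclusion (X : Type) (a : option (affine_powerset X)) :
  affine_powerset (option X) :=
  if a is Some A then powerset_map Some A else powerset_eta None.

Lemma preimage_Some_finite (X : Type) (U : affine_powerset (option X)) :
  finite_set (Some @^-1` U).
Proof.
apply: finite_preimage (elements_finite U).
by move=> x y _ _ [].
Qed.

(* The part of U lying in X if there is one, and bot otherwise, that is, when
   U = {bot}; see the three lemmas that follow. *)
Definition postselection (X : Type) (U : affine_powerset (option X)) :
  option (affine_powerset X) :=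
  if pselect (Some @^-1` U !=set0) is left U0
  then Some (AffinePowerset (preimage_Some_finite U) U0) else None.

Lemma postselection_setU (X : Type) (A : affine_powerset X)
    (U : affine_powerset (option X)) :
  elements U = (Some @` A) `|` [set None] -> postselection U = Some A.
Proof.
move=> UE; have AE : Some @^-1` U = A.
  rewrite UE; apply/seteqP; split=> [x [[y Ay [<-]]|] //|x Ax].
  by left; exists x.
rewrite /postselection; case: pselect => [U0|[]].
  by congr Some; apply: affine_powerset_ext.
by rewrite AE; exact: elements_neq0.
Qed.

Lemma postselection_image (X : Type) (A : affine_powerset X)
    (U : affine_powerset (option X)) :
  elements U = Some @` A -> postselection U = Some A.
Proof.
move=> UE; have AE : Some @^-1` U = A.
  rewrite UE; apply/seteqP; split=> [x [y Ay [<-]] //|x Ax].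
  by exists x.
rewrite /postselection; case: pselect => [U0|[]].
  by congr Some; apply: affine_powerset_ext.
by rewrite AE; exact: elements_neq0.
Qed.

Lemma postselection_bot (X : Type) (U : affine_powerset (option X)) :
  elements U = [set None] -> postselection U = None.
Proof.
move=> UE; rewrite /postselection; case: pselect => // U0; exfalso.
by case: U0 => x /=; rewrite UE.
Qed.

(* Main.v *)
Require Import Defs.
From mathcomp Require Import all_boot all_classical.

Set Implicit Arguments.
Unset Strict Implicit.
Unset Printing Implicit Defensive.

Local Open Scope classical_set_scope.

(** A non-empty finite set or bot is the same thing as a possibly empty finite
set, bot playing the role of the empty set.  Under this identification
post-selection discards bot, that is, it takes the preimage of a set under
[Some].  [support] is the identification, and it is injective
([support_inj]), so two maps into [option (affine_powerset X)] are equal as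
soon as they have the same support; [support_postselection],
[support_map], [support_mu] and [support_bind] compute the supports.
This turns the axioms on post-selection into identities between preimages,
images and unions: for instance, compatibility with the multiplication of the
maybe monad says that discarding both bots together is the same as discarding
them one after the other, and the mixed axiom on multiplication says that
preimage under [Some] commutes with unions.

The inclusion sends bot to the singleton of bot and is the direct image under
[Some] elsewhere.  By cases on whether the argument is bot, its axioms hold
because direct images respect composition, singletons and unions. *)

Definition support (X : Type) (a : option (affine_powerset X)) : set X :=
  if a is Some A then elements A else set0.

(** Non-emptiness of the members of [affine_powerset X] is what keeps them
apart from bot. *)
Lemma support_inj (X : Type) : injective (@support X).
Proof.
move=> [A|] [B|] //= AB.
- by congr Some; exact: affine_powerset_ext.
- by have [x] := elements_neq0 A; rewrite AB.
- by have [x] := elements_neq0 B; rewrite -AB.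
Qed.

Lemma support_postselection (X : Type) (U : affine_powerset (option X)) :
  support (postselection U) = Some @^-1` U.
Proof.
by rewrite /postselection; case: pselect => // /nonemptyPn ->.
Qed.

Lemma support_map (X Y : Type) (f : X -> Y) (a : option (affine_powerset X)) :
  support (omap (powerset_map f) a) = f @` support a.
Proof. by case: a => //=; rewrite image_set0. Qed.

Lemma support_mu (X : Type)
    (a : option (affine_powerset (affine_powerset X))) :
  support (omap (@powerset_mu X) a) = \bigcup_(U in support a) U.
Proof. by case: a => //=; rewrite bigcup_set0. Qed.

Lemma support_bind (X : Type) (a : option (affine_powerset (option X))) :
  support (maybe_mu (omap (@postselection X) a)) = Some @^-1` support a.
Proof. by case: a => //= U; exact: support_postselection. Qed.

(** The elements of [inclusion a] other than bot are those of the support of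
[a]; this makes post-selection a retraction of the inclusion. *)
Lemma preimage_inclusion (X : Type) (a : option (affine_powerset X)) :
  Some @^-1` inclusion a = support a.
Proof.
case: a => [A|] /=; last by apply/seteqP; split.
by apply/seteqP; split=> [x [y Ay [<-]] //|x Ax]; exists x.
Qed.

Lemma inclusion_distributive :
  distributive_law maybe_monad powerset_monad inclusion.
Proof.
split=> [X Y f|X|X|X|X]; apply/funext.
- move=> [A|]; apply: affine_powerset_ext => /=.
    by rewrite !image_comp.
  by rewrite image_set1.
- move=> [[A|]|]; apply: affine_powerset_ext => /=.
  + by rewrite !image_comp.
  + by rewrite !image_set1.
  + by rewrite image_set1.
- by [].
- move=> [A|]; apply: affine_powerset_ext => /=.
    by rewrite image_bigcup !bigcup_image.
  by rewrite image_set1 bigcup_set1.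
- move=> [x|]; apply: affine_powerset_ext => //=.
  by rewrite image_set1.
Qed.

Lemma postselection_almost_distributive :
  almost_distributive_law powerset_monad maybe_monad postselection.
Proof.
split=> [X Y f|X|X|X]; apply/funext => U; apply: support_inj => /=.
- rewrite support_map !support_postselection /=.
  apply/seteqP; split=> [y [x Ux <-]|y [[x|] //= Ux [<-]]].
    by exists (Some x).
  by exists x.
- rewrite support_bind !support_postselection /=.
  (* The multiplication identifies the two bots, so only an element
     distinct from both is mapped into the image of Some. *)
  apply/seteqP; split=> [x [[[y|]|] //= Uy [<-]] //|x Ux].
  by exists (Some (Some x)).
- rewrite support_postselection /=.
  case: U => [x|] /=; first by apply/seteqP; split=> y [->].
  by apply/seteqP; split.
- rewrite support_postselection /=.
  by apply/seteqP; split=> [x [y Uy [<-]] //|x Ux]; exists x.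
Qed.

Theorem proposition3p8 :
  sesquilaw maybe_monad powerset_monad inclusion postselection.
Proof.
split.
- exact: inclusion_distributive.
- exact: postselection_almost_distributive.
- move=> X; apply/funext => U; apply: support_inj => /=.
  rewrite support_mu !support_postselection /= bigcup_image preimage_bigcup.
  under eq_bigcupr do rewrite preimage_inclusion.
  (* Bot has empty support and contributes nothing to the union. *)
  apply/seteqP; split=> [x [[A|] //= UA Ax]|x [A UA Ax]].
    by exists A.
  by exists (Some A).
- move=> X; apply/funext => a; apply: support_inj => /=.
  by rewrite support_postselection preimage_inclusion.
Qed.
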